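(* Let $n$ and $k$ be integers with $1\le k\le n$, and let $|\mathrm{PF}_n^{(k)}|$ denote the number of parking functions of length $n$ with exactly $k$ cyclic points. Then $$|\mathrm{PF}_n^{(k)}|=\begin{cases} n! & \text{if } k=n,\\[2pt] \binom{n+1}{k}\,k\,k!\,(n+1)^{n-k-2} & \text{if } 1\le k<n.\end{cases}$$
   Context: Let $[n]=\{1,\dots,n\}$. A parking function of length $n$ is a sequence $\pi_n=(\pi_n(1),\dots,\pi_n(n))\in[n]^n$ such that $|\{k\in[n]:\pi_n(k)\le i\}|\ge i$ for all $i\in[n]$. Viewing $\pi_n$ as a map $[n]\to[n]$, its digraph $G_{\pi_n}$ is the directed graph with vertex set $[n]$ and a directed edge from $i$ to $\pi_n(i)$ for every $i\in[n]$ (a fixed point gives a self-loop, which is a cycle of length $1$). A cyclic point of $\pi_n$ is a vertex lying on a directed cycle of $G_{\pi_n}$. *)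

(* Defs.v *)
From HB Require Import structures.
From mathcomp Require Import all_boot all_order all_algebra.
Set Implicit Arguments.
Unset Strict Implicit.
Unset Printing Implicit Defensive.

(* The set [n] = {1, ..., n} is encoded as 'I_n = {0, ..., n.-1}: the ordinal
   i stands for i.+1, and a sequence pi_n in [n]^n is an element of
   {ffun 'I_n -> 'I_n}. *)

(* With the above shift, the ordinal i stands for the threshold i.+1, so the
   condition |{j : pi(j) <= i.+1}| >= i.+1 reads i.+1 <= #|...|. *)
Definition is_parking (n : nat) (pi : {ffun 'I_n -> 'I_n}) : bool :=
  [forall i : 'I_n, i.+1 <= #|[set j : 'I_n | pi j <= i]|].

Definition digraph (n : nat) (pi : {ffun 'I_n -> 'I_n}) : rel 'I_n :=
  [rel i j | pi i == j].

(* A directed cycle is a duplicate-free e-cycle; it has at most #|T| vertices,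
   which makes the quantification over cycles finite (see cyclic_pointP). A
   self-loop at x is the cycle [:: x]. *)
Definition cyclic_point (T : finType) (e : rel T) (x : T) : bool :=
  [exists m : 'I_(#|T|.+1), exists c : m.-tuple T, ucycleb e c && (x \in c)].

Lemma cyclic_pointP (T : finType) (e : rel T) (x : T) :
  reflect (exists2 c : seq T, ucycle e c & x \in c) (cyclic_point e x).
Proof.
apply: (iffP existsP) => [[m /existsP [c /andP [ec xc]]] | [c ec xc]].
  by exists c.
have sz : size c < #|T|.+1.
  by case/andP: ec => _ /card_uniqP <-; rewrite ltnS max_card.
exists (Ordinal sz); apply/existsP; exists (in_tuple c).
by apply/andP; split.
Qed.

Definition cyclic_points (n : nat) (pi : {ffun 'I_n -> 'I_n}) : {set 'I_n} :=
  [set x | cyclic_point (digraph pi) x].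

Definition PF (n k : nat) : {set {ffun 'I_n -> 'I_n}} :=
  [set pi | is_parking pi & #|cyclic_points pi| == k].

(* Main.v *)
Require Import Defs.
From HB Require Import structures.
From mathcomp Require Import all_boot all_order all_algebra.
From mathcomp Require Import zify.
Set Implicit Arguments.
Unset Strict Implicit.
Unset Printing Implicit Defensive.
Import Order.TTheory GRing.Theory Num.Theory.

(** Call the content of a map f : [n] -> T the function that sends v to the
    number of preimages of v.  Whether a map is a parking function depends on
    its content only.  The number of cyclic points does not, but it can be
    traded for a statistic that is easy to count: the run of a word w, which
    is the length of the longest prefix of w without a repeated letter.

    The pairs (content, number of cyclic points) and (content, run) are
    equidistributed on the maps [n] -> [n] ([cyclic_run_equidistributed]).
    The proof is an induction on n, as in the Pruefer code.  If the content
    vanishes nowhere, the map is a permutation and both statistics equal n.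
    Otherwise some v is not a value.  Erasing the vertex v, a leaf of the
    digraph that lies on no cycle, leaves the cyclic points untouched.  Erasing
    the last letter of a word that avoids v leaves the run untouched, because
    n letters taken among the n - 1 values other than v must contain a
    repetition.  Both erasures amount to choosing the erased value u and
    lowering the content at u by one, so both counts satisfy the same
    recurrence.

    Hence the parking functions with k cyclic points are as many as those with
    run k ([card_PF_run]).  The run, unlike the number of cyclic points, makes
    sense for words over the n + 1 residues modulo n + 1 and is invariant under
    translation of the letters.  Pollak's circle argument then applies: exactly
    one of the n + 1 translates of such a word is a parking function
    ([unique_parking_rotation]), so (n + 1) |PF_n^(k)| is the number of words
    of length n over n + 1 letters with run k.  For k < n these words are k
    distinct letters, a repetition of one of them, and n - k - 1 arbitrary
    letters; for k = n they are the injective words. *)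

Local Open Scope nat_scope.

(** * Content of a map *)

Definition content (n : nat) (T : finType) (f : {ffun 'I_n -> T}) :
    {ffun T -> nat} :=
  [ffun v => \sum_(i < n) (f i == v)].

Lemma content_eq0 n (T : finType) (f : {ffun 'I_n -> T}) v :
  (content f v == 0) = [forall i, f i != v].
Proof.
by rewrite ffunE sum_nat_eq0; apply: eq_forallb => i; rewrite eqb0.
Qed.

Lemma content_gt0_inj n (f : {ffun 'I_n -> 'I_n}) :
  (forall v, 0 < content f v) -> injective f.
Proof.
move=> pos.
suff im : [set: 'I_n] \subset f @: [set: 'I_n].
  have /imset_injP f_inj : #|f @: [set: 'I_n]| == #|[set: 'I_n]|.
    by rewrite eqn_leq leq_imset_card subset_leq_card.
  by move=> i j; apply: f_inj; rewrite inE.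
apply/subsetP => v _.
have := pos v; rewrite lt0n content_eq0 negb_forall => /existsP [i].
by rewrite negbK => /eqP <-; rewrite imset_f.
Qed.

Lemma is_parking_content n (f : {ffun 'I_n -> 'I_n}) :
  is_parking f =
    [forall i : 'I_n, i < \sum_(v : 'I_n | v <= i) content f v].
Proof.
apply: eq_forallb => i; congr (_ < _).
rewrite -sum1dep_card big_mkcond.
under [RHS]eq_bigr do rewrite ffunE.
rewrite exchange_big /=; apply: eq_bigr => j _.
rewrite big_mkcond (bigD1 (f j)) //= eqxx big1 ?addn0 // => v.
by rewrite eq_sym => /negbTE ->; case: ifP.
Qed.

(** * Inserting a position and a missing value *)

(** The map on n + 1 points that misses the value v, takes the value u (shifted
    past v) at position p, and is g (shifted likewise) at the other positions.
    Position and value are shifted independently, so that the same operation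
    grows a digraph by a leaf (p = v) and a word by a last letter (p maximal). *)
Definition insert_value n (p v : 'I_n.+1) (g : {ffun 'I_n -> 'I_n}) (u : 'I_n) :
    {ffun 'I_n.+1 -> 'I_n.+1} :=
  [ffun i => lift v (if unlift p i is Some j then g j else u)].

Lemma insert_value_lift n (p v : 'I_n.+1) g u i :
  insert_value p v g u (lift p i) = lift v (g i).
Proof. by rewrite ffunE liftK. Qed.

Lemma insert_value_at n (p v : 'I_n.+1) g u :
  insert_value p v g u p = lift v u.
Proof. by rewrite ffunE unlift_none. Qed.

Lemma insert_value_neq n (p v : 'I_n.+1) g u i :
  insert_value p v g u i != v.
Proof. by rewrite ffunE eq_sym neq_lift. Qed.

Lemma insert_value_inj n (p v : 'I_n.+1) :
  injective (fun x : 'I_n * {ffun 'I_n -> 'I_n} => insert_value p v x.2 x.1).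
Proof.
move=> [u g] [u' g'] /= /ffunP eq_ins; congr pair.
  by have := eq_ins p; rewrite !insert_value_at => /lift_inj.
apply/ffunP => i.
by have := eq_ins (lift p i); rewrite !insert_value_lift => /lift_inj.
Qed.

Lemma insert_value_onto n (p v : 'I_n.+1) (f : {ffun 'I_n.+1 -> 'I_n.+1}) :
  (forall i, f i != v) -> exists g u, f = insert_value p v g u.
Proof.
move=> fNv.
have lifted i : exists j, f i = lift v j.
  by have := fNv i; case: (unliftP v (f i)) => [j ->|->]; [exists j | rewrite eqxx].
have [u fp] := lifted p.
have [g fg] := fin_all_exists (fun i => lifted (lift p i)).
exists (finfun g), u; apply/ffunP => i; rewrite ffunE.
by case: unliftP => [j ->|->]; rewrite ?fg ?ffunE.
Qed.

Lemma content_insert_value n (p v : 'I_n.+1) g u j :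
  content (insert_value p v g u) (lift v j) = content g j + (u == j).
Proof.
rewrite !ffunE (bigD1_ord p) //= insert_value_at (inj_eq lift_inj) addnC.
by congr (_ + _); apply: eq_bigr => i _; rewrite insert_value_lift (inj_eq lift_inj).
Qed.

(** The recurrence shared by both statistics.  Its index set depends on the
    content m and on the missing value v but not on the position p, so two
    statistics that are preserved by insertion, each at a position of its own,
    satisfy the same recurrence. *)
Lemma sum_content_insert_value n (p v : 'I_n.+1) (m : {ffun 'I_n.+1 -> nat})
    (F : {ffun 'I_n.+1 -> 'I_n.+1} -> nat) :
  m v = 0 ->
  \sum_(f | content f == m) F f =
    \sum_(u : 'I_n | 0 < m (lift v u))
      \sum_(g | content g == [ffun j => m (lift v j) - (u == j)])
        F (insert_value p v g u).
Proof.
move=> mv0; rewrite pair_big_dep /=.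
pose P (x : 'I_n * {ffun 'I_n -> 'I_n}) := (0 < m (lift v x.1)) &&
  (content x.2 == [ffun j => m (lift v j) - (x.1 == j)]).
rewrite -(big_imset (h := fun x => insert_value p v x.2 x.1) (A := P) F);
  last by move=> x y _ _ /insert_value_inj.
apply: eq_bigl => f; apply/eqP/imsetP => [fm | [[u g]]].
  have [g [u f_ins]] : exists g u, f = insert_value p v g u.
    apply: insert_value_onto; apply/forallP.
    by rewrite -content_eq0 fm mv0.
  exists (u, g) => //; rewrite -[_ \in _]/(P (u, g)) /P /=.
  have mlift j : m (lift v j) = content g j + (u == j).
    by rewrite -fm f_ins content_insert_value.
  rewrite mlift eqxx addn1 /=.
  by apply/eqP/ffunP => j; rewrite [RHS]ffunE mlift addnK.
rewrite -[_ \in _]/(P (u, g)) /P /= => /andP [mu_gt0 /eqP gm] ->.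
apply/ffunP => w; case: (unliftP v w) => [j ->|->]; last first.
  apply/eqP; rewrite mv0 content_eq0; apply/forallP => i.
  exact: insert_value_neq.
rewrite content_insert_value gm ffunE subnK //.
by case: eqP => [<-|].
Qed.

(** * Cyclic points and runs *)

Lemma cyclic_point_iterP n (f : {ffun 'I_n -> 'I_n}) x :
  reflect (exists d, iter d.+1 f x = x) (x \in cyclic_points f).
Proof.
rewrite inE; apply: (iffP (cyclic_pointP _ _)) => [[c /andP [fc _] xc]|iterx].
  apply/(orbitPcycle 1 3); apply: (eq_order_cycle fc) => //.
  exact: mem_fcycle fc _ xc.
exists (orbit f x); last exact: in_orbit.
rewrite /ucycle orbit_uniq andbT.
by apply/(orbitPcycle 0 3 : fcycle f (orbit f x) <-> _).
Qed.

Lemma card_cyclic_points_inj n (f : {ffun 'I_n -> 'I_n}) :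
  injective f -> #|cyclic_points f| = n.
Proof.
move=> f_inj; rewrite -[RHS]card_ord -cardsT; congr #|pred_of_set _|.
apply/setP => x; rewrite [RHS]inE; apply/cyclic_point_iterP.
exists (order f x).-1; rewrite orderSpred; exact: iter_order.
Qed.

(** The new vertex v has no preimage, so it lies on no cycle, and [lift v]
    conjugates g to the new map on the other vertices. *)
Lemma card_cyclic_points_insert_value n (v : 'I_n.+1) g u :
  #|cyclic_points (insert_value v v g u)| = #|cyclic_points g|.
Proof.
rewrite -(card_imset (mem (cyclic_points g)) (@lift_inj _ v)).
congr #|pred_of_set _|; apply/setP => x.
have iterE d i : iter d (insert_value v v g u) (lift v i) = lift v (iter d g i).
  by elim: d => //= d ->; rewrite insert_value_lift.
apply/cyclic_point_iterP/imsetP => [[d xd]|[i /cyclic_point_iterP [d id] ->]].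
  case: (unliftP v x) xd => [i ->|->] xd.
    exists i => //; apply/cyclic_point_iterP; exists d.
    by apply: (@lift_inj _ v); rewrite -iterE.
  by have := insert_value_neq v v g u (iter d (insert_value v v g u) v);
     rewrite -iterS xd eqxx.
by exists d; rewrite iterE id.
Qed.

Definition inj_prefix n (T : finType) (w : {ffun 'I_n -> T}) (k : nat) : bool :=
  [forall i : 'I_n, forall j : 'I_n,
    (i < k) && (j < k) && (w i == w j) ==> (i == j)].

(** Prefixes of an injective prefix are injective, so the number of nonempty
    injective prefixes is the length of the longest one.  The sum makes the
    effect of a last letter visible through [big_ord_recr]. *)
Definition run n (T : finType) (w : {ffun 'I_n -> T}) : nat :=
  \sum_(i < n) inj_prefix w i.+1.

Lemma inj_prefixP n (T : finType) (w : {ffun 'I_n -> T}) k :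
  reflect (forall i j : 'I_n, i < k -> j < k -> w i = w j -> i = j)
          (inj_prefix w k).
Proof.
apply: (iffP 'forall_forallP) => [winj i j ik jk /eqP wij | winj i j].
  by apply/eqP; have := winj i j; rewrite ik jk wij.
by apply/implyP => /andP [/andP [ik jk] /eqP /winj ->].
Qed.

Lemma inj_prefix_le n (T : finType) (w : {ffun 'I_n -> T}) k l :
  k <= l -> inj_prefix w l -> inj_prefix w k.
Proof.
move=> kl /inj_prefixP winj; apply/inj_prefixP => i j ik jk.
by apply: winj; apply: leq_trans kl.
Qed.

Lemma leq_run n (T : finType) (w : {ffun 'I_n -> T}) k :
  k <= n -> (k <= run w) = inj_prefix w k.
Proof.
move: k.
have P0 : inj_prefix w 0 by apply/inj_prefixP.
have anti l : inj_prefix w l.+1 -> inj_prefix w l by apply: inj_prefix_le.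
suff main m k : k <= m ->
    (k <= \sum_(i < m) inj_prefix w i.+1) = inj_prefix w k by exact: main.
elim: m k => [|m IHm] k.
  by rewrite leqn0 => /eqP ->; rewrite P0.
rewrite big_ord_recr /= leq_eqVlt => /orP [/eqP -> {k}|]; last first.
  rewrite ltnS => km; rewrite -(IHm _ km).
  case Pm: (inj_prefix w m.+1); rewrite ?addn0 // addn1.
  have /(leq_trans km) kS := etrans (IHm m (leqnn m)) (anti m Pm).
  by rewrite kS leqW.
have le_m : \sum_(i < m) inj_prefix w i.+1 <= m.
  by rewrite -[leqRHS]card_ord -sum1_card; apply: leq_sum => i _; case: inj_prefix.
case Pm: (inj_prefix w m.+1); last by apply/negbTE; rewrite addn0 -ltnNge.
by rewrite addn1 ltnS IHm // anti.
Qed.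

Lemma run_le n (T : finType) (w : {ffun 'I_n -> T}) : run w <= n.
Proof.
by rewrite -[leqRHS]card_ord -sum1_card; apply: leq_sum => i _; case: inj_prefix.
Qed.

Lemma run_inj n (T : finType) (w : {ffun 'I_n -> T}) :
  injective w -> run w = n.
Proof.
move=> w_inj; apply/eqP; rewrite eqn_leq run_le leq_run //.
by apply/inj_prefixP => i j _ _ /w_inj.
Qed.

Lemma run_comp n (T U : finType) (h : T -> U) (w : {ffun 'I_n -> T}) :
  injective h -> run [ffun i => h (w i)] = run w.
Proof.
move=> h_inj; apply: eq_bigr => k _; congr nat_of_bool.
apply: eq_forallb => i; apply: eq_forallb => j.
by rewrite !ffunE (inj_eq h_inj).
Qed.

(** The whole new word has more letters than there are values other than v, so
    it has a repetition and its last letter does not lengthen the run. *)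
Lemma run_insert_value n (v : 'I_n.+1) g u :
  run (insert_value ord_max v g u) = run g.
Proof.
set w := insert_value _ _ _ _.
have not_inj : inj_prefix w n.+1 = false.
  apply/negP => /inj_prefixP winj.
  have /injF_onto w_onto : injective w by move=> i j; apply: winj.
  have /codomP [i vi] := w_onto v.
  by have := insert_value_neq ord_max v g u i; rewrite -/w -vi eqxx.
rewrite /run big_ord_recr /= not_inj addn0; apply: eq_bigr => k _.
congr nat_of_bool.
have wE (i : 'I_n) : w (lift ord_max i) = lift v (g i).
  exact: insert_value_lift.
apply/inj_prefixP/inj_prefixP => winj i j ik jk.
  move=> gij; apply: (@lift_inj _ ord_max); apply: winj; rewrite ?lift_max //.
  by rewrite !wE gij.
case: (unliftP ord_max i) ik => [i' ->|->]; last by rewrite /= ltnS leqNgt ltn_ord.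
case: (unliftP ord_max j) jk => [j' ->|->]; last by rewrite /= ltnS leqNgt ltn_ord.
by rewrite !lift_max !wE => j'k i'k /lift_inj /winj ->.
Qed.

(** Induction on n: if v is missing from the content, erase the vertex v on one
    side and the last letter on the other side. *)
Lemma cyclic_run_equidistributed n (m : {ffun 'I_n -> nat}) k :
  \sum_(f : {ffun 'I_n -> 'I_n} | content f == m) (#|cyclic_points f| == k) =
  \sum_(f : {ffun 'I_n -> 'I_n} | content f == m) (run f == k).
Proof.
elim: n m => [|n IHn] m.
  apply: eq_bigr => f _; have f_inj : injective f by case.
  by rewrite card_cyclic_points_inj ?run_inj.
have [/existsP [v /eqP mv0] | m_gt0] := boolP [exists v, m v == 0].
  rewrite (sum_content_insert_value v _ mv0).
  rewrite (sum_content_insert_value ord_max _ mv0).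
  apply: eq_bigr => u _.
  under eq_bigr do rewrite card_cyclic_points_insert_value.
  under [RHS]eq_bigr do rewrite run_insert_value.
  exact: IHn.
apply: eq_bigr => f /eqP fm.
have f_inj : injective f.
  apply: content_gt0_inj => v; rewrite fm lt0n.
  by move: m_gt0; rewrite negb_exists => /forallP.
by rewrite card_cyclic_points_inj ?run_inj.
Qed.

(** Sum the equidistribution over the contents of parking functions. *)
Lemma card_PF_run n k :
  #|PF n k| = #|[set w : {ffun 'I_n -> 'I_n} | is_parking w & run w == k]|.
Proof.
(* Contents are truncated to values at most n, without loss, so that they
   range over a finite type. *)
pose bounded (f : {ffun 'I_n -> 'I_n}) : {ffun 'I_n -> 'I_n.+1} :=
  [ffun v => inord (content f v)].
have boundedE f (m : {ffun 'I_n -> 'I_n.+1}) :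
    (bounded f == m) = (content f == [ffun v => m v : nat]).
  have content_lt v : content f v < n.+1.
    rewrite ltnS ffunE -[leqRHS]card_ord -sum1_card.
    by apply: leq_sum => i _; case: eqP.
  apply/eqP/eqP => [<- | fm]; apply/ffunP => v.
    by rewrite [RHS]ffunE [bounded f v]ffunE inordK.
  by rewrite ffunE fm ffunE inord_val.
have split_by_content (Q : pred {ffun 'I_n -> 'I_n}) :
    #|[set f | is_parking f & Q f]| =
    \sum_(m : {ffun 'I_n -> 'I_n.+1})
      \sum_(f | content f == [ffun v => m v : nat]) (is_parking f * Q f).
  rewrite -sum1dep_card big_mkcond (partition_big bounded xpredT) //=.
  apply: eq_bigr => m _; apply: eq_big => f; first exact: boundedE.
  by case: is_parking; case: (Q f).
rewrite /PF !split_by_content; apply: eq_bigr => m _.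
pose good := [forall i : 'I_n, i < \sum_(v : 'I_n | v <= i) m v].
have parkE f : content f == [ffun v => m v : nat] -> is_parking f = good.
  move=> /eqP fm; rewrite is_parking_content fm /good.
  by apply: eq_forallb => i; congr (_ < _); apply: eq_bigr => v _; rewrite ffunE.
under eq_bigr => f fm do rewrite (parkE f fm).
under [RHS]eq_bigr => f fm do rewrite (parkE f fm).
by rewrite -!big_distrr /= cyclic_run_equidistributed.
Qed.

(** * The circle argument *)

Definition below n (h : {ffun 'I_n -> 'I_n.+1}) (t : nat) : nat :=
  \sum_(i < n) (h i < t).

(** The parking condition for words over n + 1 letters.  At t = n it says that
    all the letters are smaller than n, so these words are the parking functions
    of length n. *)
Definition parks n (h : {ffun 'I_n -> 'I_n.+1}) : bool :=
  [forall t : 'I_n.+1, t <= below h t].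

Definition rotate n (s : 'I_n.+1) (h : {ffun 'I_n -> 'I_n.+1}) :
    {ffun 'I_n -> 'I_n.+1} :=
  [ffun i => (h i - s)%R].

Lemma val_ord_sub n (x s : 'I_n.+1) :
  ((x - s)%R : nat) = if s <= x then x - s else x + n.+1 - s.
Proof.
rewrite /= modnDmr; have := ltn_ord x; have := ltn_ord s => sn xn.
case: leqP => sx.
  rewrite (_ : x + (n.+1 - s) = x - s + n.+1); last by lia.
  by rewrite modnDr modn_small //; lia.
by rewrite modn_small; lia.
Qed.

(** Translating by - s makes s the origin of the circle.  Going around from s,
    the condition at distance t compares below h with its value at s; crossing
    the origin adds the n letters of a full turn against n + 1 steps, whence the
    strict inequality for t < s.  In other words, s is the leftmost minimiser
    of below h t - t. *)
Lemma parks_rotate n (s : 'I_n.+1) (h : {ffun 'I_n -> 'I_n.+1}) :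
  parks (rotate s h) =
    [forall t : 'I_n.+1, below h s + t + (t < s) <= below h t + s].
Proof.
have sn := ltn_ord s.
have below_noturn t : s + t <= n.+1 ->
    below (rotate s h) t + below h s = below h (s + t).
  move=> st; rewrite /below -big_split; apply: eq_bigr => i _ /=.
  rewrite ffunE val_ord_sub; have := ltn_ord (h i); case: (leqP s (h i)); lia.
have below_turn t : n.+1 <= s + t -> t <= n ->
    below (rotate s h) t + below h s = n + below h (s + t - n.+1).
  move=> st tn; transitivity (\sum_(i < n) 1 + below h (s + t - n.+1));
    last by rewrite sum1_card card_ord.
  rewrite /below -!big_split; apply: eq_bigr => i _ /=.
  rewrite ffunE val_ord_sub; have := ltn_ord (h i); case: (leqP s (h i)); lia.
apply/forallP/forallP => H t; have tn := ltn_ord t.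
  case: (leqP s t) => st.
    have dn : t - s < n.+1 by lia.
    have := H (Ordinal dn); have := below_noturn (t - s); rewrite subnKC //=.
    lia.
  have dn : t + n.+1 - s < n.+1 by lia.
  have := H (Ordinal dn); have /= := below_turn (t + n.+1 - s).
  rewrite (_ : s + (t + n.+1 - s) - n.+1 = t); last by lia.
  lia.
case: (leqP (s + t) n) => st.
  have := H (Ordinal (st : s + t < n.+1)); have := below_noturn t.
  by rewrite /=; lia.
have dn : s + t - n.+1 < n.+1 by lia.
have := H (Ordinal dn); have := below_turn t; rewrite /=; lia.
Qed.

Lemma unique_parking_rotation n (h : {ffun 'I_n -> 'I_n.+1}) :
  \sum_(s : 'I_n.+1) parks (rotate s h) = 1.
Proof.
(* Lexicographic encoding of the pair (below h t - t, t), the first entry being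
   shifted by n to stay nonnegative; it is injective in t and its minimiser is
   the leftmost minimiser of below h t - t. *)
pose height (t : 'I_n.+1) := (below h t + (n - t)) * n.+1 + t.
have parksE s : parks (rotate s h) = [forall t, height s <= height t].
  rewrite parks_rotate; apply: eq_forallb => t; rewrite /height.
  have := ltn_ord s; have := ltn_ord t => tn sn; apply/idP/idP; nia.
case: (@arg_minnP _ ord0 xpredT height) => // s _ s_min.
rewrite (bigD1 s) //= big1 => [|t tNs].
  by rewrite parksE; case: forallP => // -[] t; apply: s_min.
apply/eqP; rewrite eqb0; apply: contra tNs; rewrite parksE => /forallP t_min.
have : height s = height t by apply/eqP; rewrite eqn_leq t_min s_min.
move=> /(congr1 (modn^~ n.+1)); rewrite /height !modnMDl !modn_small //.
by move=> st; apply/eqP/val_inj.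
Qed.

Lemma rotate_bij n (s : 'I_n.+1) : bijective (@rotate n s).
Proof.
exists (rotate (- s)%R) => h; apply/ffunP => i;
  by rewrite !ffunE ?opprK ?addrK ?subrK.
Qed.

(** Each word with run k is counted through its unique parking translate, and
    translations preserve the run. *)
Lemma card_parks_run n k :
  n.+1 * #|[set h : {ffun 'I_n -> 'I_n.+1} | parks h & run h == k]| =
  #|[set h : {ffun 'I_n -> 'I_n.+1} | run h == k]|.
Proof.
rewrite -[RHS]sum1dep_card.
under [RHS]eq_bigr => h _ do rewrite -(unique_parking_rotation h).
set parked := [set h | _ & _].
have -> : n.+1 * #|parked| = \sum_(s < n.+1) #|parked|.
  by rewrite sum_nat_const card_ord.
rewrite exchange_big /=; apply: eq_bigr => s _.
rewrite -sum1dep_card [LHS]big_mkcond [RHS]big_mkcond /=.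
rewrite (reindex (rotate s)) /=; last exact: onW_bij (rotate_bij s).
apply: eq_bigr => h _.
have -> : run (rotate s h) = run h by exact: run_comp (@addIr _ (- s)%R).
by case: parks; case: eqP.
Qed.

Lemma card_parking_run n k :
  #|[set w : {ffun 'I_n -> 'I_n} | is_parking w & run w == k]| =
  #|[set h : {ffun 'I_n -> 'I_n.+1} | parks h & run h == k]|.
Proof.
pose widen (w : {ffun 'I_n -> 'I_n}) : {ffun 'I_n -> 'I_n.+1} :=
  [ffun i => lift ord_max (w i)].
have widen_inj : injective widen.
  move=> w w' /ffunP eqw; apply/ffunP => i.
  by have := eqw i; rewrite !ffunE => /lift_inj.
have belowE w t : below (widen w) t = #|[set j | w j < t]|.
  rewrite -sum1dep_card big_mkcond; apply: eq_bigr => i _.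
  by rewrite ffunE lift_max; case: leqP.
have parksE w : parks (widen w) = is_parking w.
  apply/forallP/forallP => park t.
    have := park (lift ord0 t); rewrite lift0 belowE.
    by under eq_finset do rewrite ltnS.
  case: (unliftP ord0 t) => [t' ->|-> //]; rewrite lift0 belowE.
  by under eq_finset do rewrite ltnS; apply: park.
rewrite -(card_imset _ widen_inj); apply: eq_card => h.
rewrite [RHS]inE; apply/imsetP/andP => [[w + ->]|[park /eqP run_h]].
  by rewrite inE -parksE (run_comp _ (@lift_inj _ ord_max)) => /andP.
have lt_h i : h i != ord_max.
  have := forallP park ord_max; apply: contraTneq => hi.
  rewrite -ltnNge /below (bigD1 i) //= hi ltnn add0n.
  have others : (\sum_(j < n | j != i) 1).+1 = n.
    by rewrite -[RHS]card_ord -sum1_card [RHS](bigD1 i).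
  by rewrite -[ltnRHS]others ltnS; apply: leq_sum => j _; case: ltnP.
have lifted i : exists j, h i = lift ord_max j.
  by have := lt_h i; case: (unliftP ord_max (h i)) => [j ->|->];
    [exists j | rewrite eqxx].
have [w hw] := fin_all_exists lifted.
have hE : h = widen (finfun w) by apply/ffunP => i; rewrite !ffunE hw.
exists (finfun w) => //; rewrite inE -parksE -hE park.
by rewrite -run_h hE (run_comp _ (@lift_inj _ ord_max)) eqxx.
Qed.

(** * Counting words by their run *)

Lemma card_inj_prefix (T : finType) k m :
  #|[set w : {ffun 'I_(k + m) -> T} | inj_prefix w k]| =
  #|T| ^_ k * #|T| ^ m.
Proof.
pose join (x : {ffun 'I_k -> T} * {ffun 'I_m -> T}) : {ffun 'I_(k + m) -> T} :=
  [ffun i => match split i with inl j => x.1 j | inr j => x.2 j end].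
pose cut (w : {ffun 'I_(k + m) -> T}) : {ffun 'I_k -> T} * {ffun 'I_m -> T} :=
  ([ffun j => w (lshift m j)], [ffun j => w (rshift k j)]).
have cutK : cancel cut join.
  move=> w; apply/ffunP => i; rewrite !ffunE.
  by case: split_ordP => j ->; rewrite ffunE.
have cut_inj : injective cut := can_inj cutK.
have joinK : cancel join cut.
  move=> [a b]; congr pair; apply/ffunP => j; rewrite !ffunE.
    by rewrite (unsplitK (inl _ j)).
  by rewrite (unsplitK (inr _ j)).
rewrite -[k in _ ^_ k]card_ord -card_inj_ffuns -[m in RHS]card_ord -card_ffun.
rewrite -cardsT -cardsX -(card_imset _ cut_inj); apply: eq_card => x.
rewrite [RHS]inE [_ \in setT]inE andbT [RHS]inE -[x in LHS]joinK.
rewrite (mem_imset _ _ cut_inj) inE.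
apply/inj_prefixP/injectiveP => xinj i j.
  move=> xij; apply: (@lshift_inj k m); apply: xinj; rewrite /= ?ltn_ord //.
  by rewrite !ffunE !(unsplitK (inl _ _)).
case: (split_ordP i) => i' ->; case: (split_ordP j) => j' -> //= + +;
  rewrite ?ltnNge ?leq_addr // => _ _.
by rewrite !ffunE !(unsplitK (inl _ _)) => /xinj ->.
Qed.

Lemma card_run_ge (T : finType) n k :
  k <= n ->
  #|[set w : {ffun 'I_n -> T} | k <= run w]| = #|T| ^_ k * #|T| ^ (n - k).
Proof.
move=> kn; have := @card_inj_prefix T k (n - k).
rewrite subnKC // => <-; apply: eq_card => w.
by rewrite !inE leq_run.
Qed.

(** Such words are those with run at least k minus those with run at least
    k + 1; the factor k is |T| - (|T| - k). *)
Lemma card_run (T : finType) n k :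
  k < n ->
  #|[set w : {ffun 'I_n -> T} | run w == k]| = #|T| ^_ k * k * #|T| ^ (n - k.+1).
Proof.
move=> kn.
have ge_split : #|[set w : {ffun 'I_n -> T} | k <= run w]| =
    #|[set w : {ffun 'I_n -> T} | run w == k]| +
    #|[set w : {ffun 'I_n -> T} | k < run w]|.
  rewrite -!sum1dep_card [in LHS]big_mkcond [X in _ = X + _]big_mkcond.
  rewrite [X in _ = _ + X]big_mkcond -big_split /=.
  by apply: eq_bigr => w _; case: ltngtP.
move: ge_split; rewrite !card_run_ge // 1?ltnW // -subnSK // expnS ffactnSr.
case: (leqP k #|T|) => kT count_ge; last first.
  move: count_ge; rewrite ffact_small // !mul0n => /esym/eqP.
  by rewrite addn_eq0 => /andP [/eqP].
apply: (@addIn (#|T| ^_ k * (#|T| - k) * #|T| ^ (n - k.+1))).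
by rewrite -count_ge -mulnDl -mulnDr subnKC // mulnA.
Qed.

Lemma card_run_full (T : finType) n :
  #|[set w : {ffun 'I_n -> T} | run w == n]| = #|T| ^_ n.
Proof.
rewrite -[RHS]muln1 -(expn0 #|T|) -(subnn n) -card_run_ge //.
by apply: eq_card => w; rewrite !inE eqn_leq run_le.
Qed.

Lemma card_PF n k :
  k <= n ->
  n.+1 * #|PF n k| =
    if k == n then n.+1`! else n.+1 ^_ k * k * n.+1 ^ (n - k.+1).
Proof.
move=> kn; rewrite card_PF_run card_parking_run card_parks_run.
case: eqVneq => [->|kNn].
  by rewrite card_run_full card_ord -(ffact_fact (leqnSn n)) subSnn muln1.
by rewrite card_run ?card_ord // ltn_neqAle kNn.
Qed.

Local Open Scope ring_scope.

Theorem theorem3p1 (n k : nat) (hk : (1 <= k <= n)%N) :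
  (#|PF n k|)%:R =
    (if k == n then (n`!)%:R
     else ('C(n.+1, k))%:R * k%:R * (k`!)%:R
          * (n.+1)%:R ^ (n%:Z - k%:Z - 2)) :> rat.
Proof.
have [_ kn] := andP hk.
have n1_neq0 : n.+1%:R != 0 :> rat by rewrite pnatr_eq0.
(* For k = n - 1 the exponent is -1: multiplying by n + 1 brings the formula
   back to natural numbers. *)
apply: (mulfI n1_neq0); rewrite -[LHS]natrM card_PF //.
case: eqVneq => [_|kNn]; first by rewrite factS natrM.
have -> : n%:Z - k%:Z - 2 = (n - k.+1)%N%:Z - 1 by lia.
rewrite expfzDr // -exprnP exprN1 -bin_ffact !natrM natrX.
by rewrite [RHS]mulrC -[RHS]mulrA mulfVK // (mulrAC _ k`!%:R).
Qed.
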